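(* Let $R=\mathbb{C}[x_1,\ldots,x_n]$, let $R_{x_1\cdots x_n}=\mathbb{C}[x_1,x_1^{-1},\ldots,x_n,x_n^{-1}]$, let $I=\langle f_1,\ldots,f_s\rangle\subset R_{x_1\cdots x_n}$ be a zero-dimensional ideal generated by $s$ Laurent polynomials, and let $I^*=I\cdot R_{x_1\cdots x_n}\cap R$. Let $\mathcal{S}\subset\mathbb{N}^n$ be a finite set, $V=\bigoplus_{\alpha\in\mathcal{S}}\mathbb{C}\cdot x^\alpha\subset R$, and let $N:V\to\mathbb{C}^\delta$ be a $\mathbb{C}$-linear map. Assume that $\dim_{\mathbb{C}}R/I^*=\delta>0$ (with $\delta<\infty$) and that $\ker(N)\subset I\cap V$. Suppose that there is a vector subspace $W\subset V$ such that $x_i\cdot W\subset V$ for $i=1,\ldots,n$ and such that the restriction $N_{|W}$ has rank $\delta$. Then for any vector subspace $B\subset W$ such that $W=B\oplus\ker(N_{|W})$: (i) $N^*:=N_{|B}:B\to\mathbb{C}^\delta$ is invertible; (ii) $V=B\oplus(V\cap I^* )$ and $(\langle\ker(N)\rangle:u)=I^*$ for any monomial $u\in V$; (iii) there is an isomorphism of $R$-modules $B\simeq R/I^*$; (iv) for $i=1,\ldots,n$, the map $N_i:B\to\mathbb{C}^\delta$, $b\mapsto N(x_i\cdot b)$, decomposes as $N_i=N^*\circ m_{x_i}$, where the maps $m_{x_i}:B\to B$ define the multiplications by $x_i$ in $B$ modulo $I^*$ and are commuting.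
   Context: $\langle\ker(N)\rangle$ is the ideal of $R$ generated by $\ker(N)$. For an ideal $J\subset R$ and $p\in R$, $(J:p)=\{q\in R\mid pq\in J\}$. That $m_{x_i}:B\to B$ is the multiplication by $x_i$ in $B$ modulo $I^*$ means that $m_{x_i}(b)\in B$ and $m_{x_i}(b)\equiv x_i\cdot b\mod I^*$ for all $b\in B$. Explicitly, $m_{x_i}(b)=\pi(x_i\cdot b)$, where $\pi:V\to B$ is the projection onto $B$ along $\ker(N)$ (one has $V=B\oplus\ker(N)$). In (iii), the $R$-module structure on $B$ is the one in which $x_i$ acts as $m_{x_i}$. *)

(* Defs.v *)
From HB Require Import structures.
From mathcomp Require Import all_boot all_order all_algebra.
From mathcomp Require Import finmap ssrcomplements mpoly.
From mathcomp Require Import generic_quotient ring_quotient fraction.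
From mathcomp Require Import complex boolp reals.

Set Implicit Arguments.
Unset Strict Implicit.
Unset Printing Implicit Defensive.

Import GRing.Theory.
Local Open Scope ring_scope.
Local Open Scope quotient_scope.

(* The library's [idealr] only covers proper ideals; here the unit ideal is   *)
(* allowed, since properness is not known a priori for generated ideals.      *)
Record ideal (A : comNzRingType) := Ideal {
  ideal_pred :> {pred A};
  ideal_zmod_closed : zmod_closed ideal_pred;
  ideal_mull : forall a x, x \in ideal_pred -> a * x \in ideal_pred }.

HB.instance Definition _ (A : comNzRingType) (I : ideal A) :=
  GRing.isZmodClosed.Build A (ideal_pred I) (ideal_zmod_closed I).

Section GeneratedIdeal.
Variables (A : comNzRingType) (G : A -> Prop).

Definition gen_pred : {pred A} := fun x =>
  `[< exists k (a g : 'I_k -> A),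
        (forall i, G (g i)) /\ x = \sum_i a i * g i >].

Fact gen_zmod_closed : zmod_closed gen_pred.
Proof.
split=> [|x y].
  apply/asboolP; exists 0%N, (fun=> 0), (fun=> 0).
  by split=> [[]//|]; rewrite big_ord0.
move=> /asboolP[k [a [g [Gg ->]]]] /asboolP[l [b [h [Gh ->]]]].
apply/asboolP; exists (k + l)%N.
exists (fun i => match split i with inl u => a u | inr v => - b v end).
exists (fun i => match split i with inl u => g u | inr v => h v end).
split=> [i|]; first by case: (split i).
rewrite big_split_ord /= -sumrN; congr (_ + _); apply: eq_bigr => i _.
  by rewrite (unsplitK (inl i)).
by rewrite (unsplitK (inr i)) mulNr.
Qed.

Fact gen_mull a x : x \in gen_pred -> a * x \in gen_pred.
Proof.
move=> /asboolP[k [b [g [Gg ->]]]]; apply/asboolP.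
exists k, (fun i => a * b i), g; split=> //.
by rewrite mulr_sumr; apply: eq_bigr => i _; rewrite mulrA.
Qed.

Definition gen_ideal : ideal A := Ideal gen_zmod_closed gen_mull.
End GeneratedIdeal.

Section ContractedIdeal.
Variables (A A' : comNzRingType) (h : {rmorphism A -> A'}) (I : ideal A').

Definition contr_pred : {pred A} := fun x => h x \in I.

Fact contr_zmod_closed : zmod_closed contr_pred.
Proof.
split=> [|x y]; rewrite unfold_in ?rmorph0 ?rpred0 // => hx hy.
by rewrite unfold_in rmorphB rpredB.
Qed.

Fact contr_mull a x : x \in contr_pred -> a * x \in contr_pred.
Proof. by rewrite !unfold_in rmorphM; apply: ideal_mull. Qed.

Definition contr_ideal : ideal A := Ideal contr_zmod_closed contr_mull.
End ContractedIdeal.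

Section ColonIdeal.
Variables (A : comNzRingType) (J : ideal A) (p : A).

Definition colon_pred : {pred A} := fun q => p * q \in J.

Fact colon_zmod_closed : zmod_closed colon_pred.
Proof.
split=> [|x y]; rewrite unfold_in ?mulr0 ?rpred0 // => hx hy.
by rewrite unfold_in mulrBr rpredB.
Qed.

Fact colon_mull a x : x \in colon_pred -> a * x \in colon_pred.
Proof. by rewrite !unfold_in mulrCA; apply: ideal_mull. Qed.

Definition colon_ideal : ideal A := Ideal colon_zmod_closed colon_mull.
End ColonIdeal.

(* A / I as an A-module. *)
Section Quotient.
Variables (A : comNzRingType) (I : ideal A).

Definition quotmod : Type := Quotient.quot (ideal_pred I).
HB.instance Definition _ := GRing.Zmodule.on quotmod.

Definition quot_proj (x : A) : quotmod := \pi_(Quotient.quot (ideal_pred I)) x.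
Definition quot_scale (a : A) (q : quotmod) : quotmod :=
  quot_proj (a * repr (q : Quotient.quot (ideal_pred I))).

Lemma quot_projE x y : (quot_proj x = quot_proj y) <-> (x - y \in I).
Proof.
by split=> [/eqP|h]; last apply/eqP; rewrite -Quotient.idealrBE.
Qed.

Lemma quot_projP (q : quotmod) : {x | q = quot_proj x}.
Proof.
exists (repr (q : Quotient.quot (ideal_pred I))).
by rewrite /quot_proj reprK.
Qed.

Lemma quot_projD x y : quot_proj (x + y) = quot_proj x + quot_proj y.
Proof. exact: (Quotient.pi_add (ideal_pred I) x y). Qed.

Lemma quot_scaleE a x : quot_scale a (quot_proj x) = quot_proj (a * x).
Proof.
apply/quot_projE; rewrite -mulrBr; apply: ideal_mull.
by apply/quot_projE; rewrite /quot_proj reprK.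
Qed.

Fact quot_scaleA a b q : quot_scale a (quot_scale b q) = quot_scale (a * b) q.
Proof. by have [x ->] := quot_projP q; rewrite !quot_scaleE mulrA. Qed.

Fact quot_scale1 : left_id 1 quot_scale.
Proof. by move=> q; have [x ->] := quot_projP q; rewrite quot_scaleE mul1r. Qed.

Fact quot_scaleDr : right_distributive quot_scale +%R.
Proof.
move=> a q r; have [x ->] := quot_projP q; have [y ->] := quot_projP r.
by rewrite -quot_projD !quot_scaleE mulrDr quot_projD.
Qed.

Fact quot_scaleDl q : {morph quot_scale^~ q : a b / a + b}.
Proof.
move=> a b; have [x ->] := quot_projP q.
by rewrite !quot_scaleE mulrDl quot_projD.
Qed.

HB.instance Definition _ := GRing.Zmodule_isLmodule.Build A quotmod
  quot_scaleA quot_scale1 quot_scaleDr quot_scaleDl.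
End Quotient.

(* The A-module M, viewed as a K-vector space along h : K -> A, has dimension *)
(* d: it has a basis of d elements.                                           *)
Definition has_dim (K : fieldType) (A : comNzRingType) (h : {rmorphism K -> A})
    (M : lmodType A) (d : nat) : Prop :=
  exists e : 'I_d -> M, forall v : M,
    exists! c : 'rV[K]_d, v = \sum_i h (c 0 i) *: e i.

(* Laurent polynomials: the fractions p / x^a inside the field of fractions   *)
(* of K[x_1, ..., x_n].                                                       *)
Section Laurent.
Variables (K : fieldType) (n : nat).
Local Notation P := {mpoly K[n]}.

Definition laurent_pred : {pred {fraction P}} := fun x =>
  `[< exists (p : P) (a : 'X_{1..n}),
        x = FracField.tofrac p / FracField.tofrac 'X_[a] >].

Let X_neq0 (a : 'X_{1..n}) : FracField.tofrac ('X_[a] : P) != 0.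
Proof.
rewrite tofrac_eq0; apply/eqP => /(congr1 (mcoeff a)) /eqP.
by rewrite mcoeffX eqxx mcoeff0 oner_eq0.
Qed.

Fact laurent_subring_closed : subring_closed laurent_pred.
Proof.
split=> [|x y|x y].
- apply/asboolP; exists 1, 0%MM.
  by rewrite mpolyX0 tofrac1 divr1.
- move=> /asboolP[p [a ->]] /asboolP[q [b ->]]; apply/asboolP.
  exists (p * 'X_[b] - q * 'X_[a]), (a + b)%MM.
  rewrite mpolyXD tofracB !tofracM -mulNr addf_div ?X_neq0 //.
  by rewrite mulNr.
- move=> /asboolP[p [a ->]] /asboolP[q [b ->]]; apply/asboolP.
  by exists (p * q), (a + b)%MM; rewrite mpolyXD !tofracM mulf_div.
Qed.

HB.instance Definition _ :=
  GRing.isSubringClosed.Build {fraction P} laurent_pred laurent_subring_closed.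

Record laurent := MkLaurent {
  laurent_val :> {fraction P};
  _ : laurent_val \in laurent_pred }.

HB.instance Definition _ := [isSub for laurent_val].
HB.instance Definition _ := [Choice of laurent by <:].
HB.instance Definition _ := [SubChoice_isSubComNzRing of laurent by <:].

Fact laurent_of_subproof (p : P) : FracField.tofrac p \in laurent_pred.
Proof. by apply/asboolP; exists p, 0%MM; rewrite mpolyX0 tofrac1 divr1. Qed.

Definition laurent_of (p : P) : laurent := MkLaurent (laurent_of_subproof p).

Fact laurent_of_zmod_morphism : zmod_morphism laurent_of.
Proof. by move=> p q; apply: val_inj; rewrite /= tofracB. Qed.

Fact laurent_of_monoid_morphism : monoid_morphism laurent_of.
Proof.
by split=> [|p q]; apply: val_inj; rewrite /= ?tofrac1 ?tofracM.
Qed.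

HB.instance Definition _ :=
  GRing.isZmodMorphism.Build P laurent laurent_of laurent_of_zmod_morphism.
HB.instance Definition _ :=
  GRing.isMonoidMorphism.Build P laurent laurent_of laurent_of_monoid_morphism.

(* Zero-dimensional: the coordinate ring is a finite-dimensional K-space. *)
Definition zero_dimensional (I : ideal laurent) : Prop :=
  exists d, has_dim (laurent_of \o @mpolyC n K) (quotmod I) d.

Definition laurent_ideal (s : nat) (f : 'I_s -> laurent) : ideal laurent :=
  gen_ideal (fun g => exists j, g = f j).

(* I^* = I \cap K[x_1, ..., x_n] *)
Definition star_ideal (I : ideal laurent) : ideal P := contr_ideal laurent_of I.
End Laurent.

(* V = \bigoplus_(a in S) K x^a, as a finite-dimensional vector space. *)
Section MonomialSpan.
Variables (K : fieldType) (n : nat) (S : {fset 'X_{1..n}}).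
Local Notation P := {mpoly K[n]}.

Definition mspan_pred : {pred P} := fun p => all (mem S) (msupp p).

Lemma mspan_predP (p : P) :
  reflect (forall a, a \notin S -> p@_a = 0) (p \in mspan_pred).
Proof.
apply: (iffP allP) => [h a aS|h a].
  by apply/eqP; rewrite mcoeff_eq0; apply: contra aS => /h.
by rewrite mcoeff_msupp; apply: contraR => /h ->.
Qed.

Fact mspan_submod_closed : submod_closed mspan_pred.
Proof.
split=> [|c p q /mspan_predP hp /mspan_predP hq].
  by apply/mspan_predP => a _; rewrite mcoeff0.
apply/mspan_predP => a aS.
by rewrite mcoeffD mcoeffZ hp // hq // mulr0 addr0.
Qed.

HB.instance Definition _ :=
  GRing.isSubmodClosed.Build K P mspan_pred mspan_submod_closed.

Record mspan := MSpan { mspan_val :> P; _ : mspan_val \in mspan_pred }.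

HB.instance Definition _ := [isSub for mspan_val].
HB.instance Definition _ := [Choice of mspan by <:].
HB.instance Definition _ := [SubChoice_isSubZmodule of mspan by <:].
HB.instance Definition _ := [SubZmodule_isSubLmodule of mspan by <:].

(* The projection of K[x_1, ..., x_n] onto V forgetting the monomials not in  *)
(* S.                                                                         *)
Definition trunc_poly (p : P) : P := \sum_(a : S) p@_(val a) *: 'X_[val a].

Lemma mcoeff_trunc (p : P) a : (trunc_poly p)@_a = if a \in S then p@_a else 0.
Proof.
rewrite raddf_sum /=; case: ifPn => aS.
  rewrite (bigD1 [` aS]%fset) //= mcoeffZ mcoeffX eqxx mulr1 big1 ?addr0 //.
  move=> b; rewrite -val_eqE /= => /negPf ba.
  by rewrite mcoeffZ mcoeffX ba mulr0.
rewrite big1 // => b _; rewrite mcoeffZ mcoeffX.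
by case: eqP => [ba|_]; [rewrite -ba fsvalP in aS | rewrite mulr0].
Qed.

Fact trunc_subproof (p : P) : trunc_poly p \in mspan_pred.
Proof. by apply/mspan_predP => a aS; rewrite mcoeff_trunc (negPf aS). Qed.

Definition trunc (p : P) : mspan := MSpan (trunc_subproof p).

Fact trunc_is_linear : linear trunc.
Proof.
move=> c p q; apply/val_inj/mpolyP => a /=.
rewrite mcoeffD mcoeffZ !mcoeff_trunc mcoeffD mcoeffZ.
by case: ifP => // _; rewrite mulr0 addr0.
Qed.

HB.instance Definition _ := GRing.isSemilinear.Build K P mspan _ trunc
  (GRing.semilinear_linear trunc_is_linear).

Fact mspan_val_is_linear : linear mspan_val.
Proof. by []. Qed.

HB.instance Definition _ := GRing.isSemilinear.Build K mspan P _ mspan_val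
  (GRing.semilinear_linear mspan_val_is_linear).

Lemma truncK (p : P) : p \in mspan_pred -> trunc p = p :> P.
Proof.
move=> /mspan_predP hp; apply/mpolyP => a; rewrite mcoeff_trunc.
by case: ifPn => // /hp.
Qed.

Fact mspan_vect_iso : Vector.axiom #|{: S}| mspan.
Proof.
exists (fun v : mspan => \row_(i < #|{: S}|) (v : P)@_(val (enum_val i))).
  by move=> c v w; apply/rowP => i; rewrite !mxE mcoeffD mcoeffZ.
exists (fun r : 'rV_#|{: S}| =>
          trunc (\sum_(a : S) r 0 (enum_rank a) *: 'X_[val a])).
  move=> v; apply: val_inj; rewrite /= -[RHS]truncK ?(valP v) //=.
  apply/mpolyP => a; rewrite !mcoeff_trunc; case: ifPn => // aS.
  rewrite raddf_sum (bigD1 [` aS]%fset) //= mxE enum_rankK mcoeffZ mcoeffX.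
  rewrite eqxx mulr1 big1 ?addr0 // => b; rewrite -val_eqE /= => /negPf ba.
  by rewrite mcoeffZ mcoeffX ba mulr0.
move=> r; apply/rowP => i; rewrite mxE mcoeff_trunc fsvalP raddf_sum.
rewrite (bigD1 (enum_val i)) //= enum_valK mcoeffZ mcoeffX eqxx mulr1.
rewrite big1 ?addr0 // => b; rewrite -val_eqE /= => /negPf ba.
by rewrite mcoeffZ mcoeffX ba mulr0.
Qed.

HB.instance Definition _ := Lmodule_hasFinDim.Build K mspan mspan_vect_iso.

(* v |-> x_i v as a linear endomorphism of V; the truncation is the identity  *)
(* whenever x_i v lies in V (see [mulXE]).                                    *)
Definition mulX_fun (i : 'I_n) (v : mspan) : mspan := trunc ('X_i * (v : P)).

Fact mulX_fun_is_linear i : linear (mulX_fun i).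
Proof.
by move=> c v w; rewrite /mulX_fun linearP /= mulrDr -scalerAr linearP.
Qed.

HB.instance Definition _ i := GRing.isSemilinear.Build K mspan mspan _
  (mulX_fun i) (GRing.semilinear_linear (mulX_fun_is_linear i)).

Definition mulX (i : 'I_n) : 'End(mspan) := linfun (mulX_fun i).

Lemma mulXE i (v : mspan) :
  'X_i * (v : P) \in mspan_pred -> mulX i v = 'X_i * (v : P) :> P.
Proof. by move=> h; rewrite lfunE -[RHS]truncK. Qed.

Section Multiplication.
Variables (d : nat) (N : 'Hom(mspan, 'cV[K]_d)) (B : {vspace mspan}).

(* m_(x_i) : b |-> \pi (x_i b), with \pi the projection onto B along ker N. *)
Definition mult_op (i : 'I_n) : 'End(subvs_of B) :=
  linfun (vsproj B \o daddv_pi B (lker N) \o mulX i \o vsval).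

Lemma mult_opE i (b : subvs_of B) :
  vsval (mult_op i b) = daddv_pi B (lker N) (mulX i (vsval b)).
Proof. by rewrite lfunE /= vsprojK ?memv_pi. Qed.
End Multiplication.
End MonomialSpan.
Arguments mulX {K n S} i.

(* The K[x_1, ..., x_n]-module structure on a K-space E in which x_i acts as  *)
(* the operator m i, for pairwise commuting m.                                *)
Section PolyModule.
Variables (K : fieldType) (n : nat) (E : vectType K).
Local Notation P := {mpoly K[n]}.

Definition commuting (m : 'I_n -> 'End(E)) : Prop :=
  forall i j (v : E), m i (m j v) = m j (m i v).

Variables (m : 'I_n -> 'End(E)) (mC : commuting m).

Definition mnm_act (a : 'X_{1..n}) (v : E) : E :=
  foldr (fun i => iter (a i) (m i)) v (enum 'I_n).

Definition poly_act (p : P) (v : E) : E :=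
  \sum_(a <- msupp p) p@_a *: mnm_act a v.

Fact iter_linear k i : linear (iter k (m i)).
Proof. by elim: k => // k IH c v w /=; rewrite IH linearP. Qed.

Fact mnm_act_linear a : linear (mnm_act a).
Proof.
rewrite /mnm_act; elim: (enum _) => // i r IH c v w /=.
by rewrite IH iter_linear.
Qed.

HB.instance Definition _ a := GRing.isSemilinear.Build K E E _ (mnm_act a)
  (GRing.semilinear_linear (mnm_act_linear a)).

Lemma poly_actE k (p : P) v : (msize p <= k)%N ->
  poly_act p v = \sum_(a : 'X_{1..n < k}) p@_a *: mnm_act a v.
Proof.
move=> le_pk; rewrite /poly_act (big_mksub 'X_{1..n < k}) ?msupp_uniq //=.
  by rewrite big_rmcond //= => a /memN_msupp_eq0 ->; rewrite scale0r.
by move=> a /msize_mdeg_lt /leq_trans; apply.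
Qed.

Fact poly_actDl v : {morph poly_act^~ v : p q / p + q}.
Proof.
move=> p q; pose k := maxn (msize (p + q)) (maxn (msize p) (msize q)).
rewrite !(@poly_actE k) ?leq_max ?leqnn ?orbT // -big_split /=.
by apply: eq_bigr => a _; rewrite mcoeffD scalerDl.
Qed.

Fact poly_actDr : right_distributive poly_act +%R.
Proof.
move=> p v w; rewrite /poly_act -big_split /=.
by apply: eq_bigr => a _; rewrite linearD scalerDr.
Qed.

Lemma poly_actZ c (p : P) v : poly_act (c *: p) v = c *: poly_act p v.
Proof.
pose k := maxn (msize (c *: p)) (msize p).
rewrite !(@poly_actE k) ?leq_max ?leqnn ?orbT // scaler_sumr.
by apply: eq_bigr => a _; rewrite mcoeffZ scalerA.
Qed.

Lemma poly_actX a v : poly_act 'X_[a] v = mnm_act a v.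
Proof. by rewrite /poly_act msuppX big_seq1 mcoeffX eqxx scale1r. Qed.

Lemma mnm_act0 v : mnm_act 0%MM v = v.
Proof.
by rewrite /mnm_act; elim: (enum _) => //= i r ->; rewrite mnm0E.
Qed.

Fact iterC i j k l v :
  iter k (m i) (iter l (m j) v) = iter l (m j) (iter k (m i) v).
Proof.
have C1 u : m i (iter l (m j) u) = iter l (m j) (m i u).
  by elim: l => //= l <-; rewrite mC.
by elim: k => //= k ->; rewrite C1.
Qed.

Lemma mnm_actD a b v : mnm_act (a + b)%MM v = mnm_act a (mnm_act b v).
Proof.
rewrite /mnm_act; elim: (enum _) => //= i r ->.
have swap s u : iter (b i) (m i) (foldr (fun j => iter (a j) (m j)) u s)
              = foldr (fun j => iter (a j) (m j)) (iter (b i) (m i) u) s.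
  by elim: s => //= j s <-; rewrite iterC.
by rewrite mnmDE iterD swap.
Qed.

Lemma poly_act0l v : poly_act 0 v = 0.
Proof. by rewrite -[0 in LHS](scale0r (0 : P)) poly_actZ scale0r. Qed.

Lemma poly_act0r p : poly_act p 0 = 0.
Proof. by rewrite /poly_act big1 // => a _; rewrite linear0 scaler0. Qed.

Lemma poly_actZr c p v : poly_act p (c *: v) = c *: poly_act p v.
Proof.
rewrite /poly_act scaler_sumr; apply: eq_bigr => a _.
by rewrite linearZ /= !scalerA mulrC.
Qed.

Fact poly_actA p q v : poly_act p (poly_act q v) = poly_act (p * q) v.
Proof.
elim/mpolyind: p q => [|c a p _ _ IHp] q; first by rewrite mul0r !poly_act0l.
rewrite mulrDl !poly_actDl IHp -scalerAl !poly_actZ; congr (_ *: _ + _).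
elim/mpolyind: q {IHp} => [|d b q _ _ IHq].
  by rewrite mulr0 !poly_act0l poly_act0r.
rewrite mulrDr !poly_actDl poly_actDr IHq -scalerAr !poly_actZ poly_actZr.
by rewrite -mpolyXD !poly_actX mnm_actD.
Qed.

Fact poly_act1 : left_id 1 poly_act.
Proof. by move=> v; rewrite -mpolyX0 poly_actX mnm_act0. Qed.

Definition polymod of commuting m : Type := E.
HB.instance Definition _ := GRing.Zmodule.on (polymod mC).
HB.instance Definition _ := GRing.Zmodule_isLmodule.Build P (polymod mC)
  poly_actA poly_act1 poly_actDr poly_actDl.

Lemma polymod_scaleX i (v : polymod mC) : ('X_i : P) *: v = m i v :> E.
Proof.
transitivity (mnm_act U_(i)%MM v); first exact: poly_actX.
rewrite /mnm_act; have : i \in enum 'I_n by rewrite mem_enum.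
have : uniq (enum 'I_n) by apply: enum_uniq.
have out s : i \notin s ->
    foldr (fun j => iter (U_(i)%MM j) (m j)) (v : E) s = v.
  elim: s => //= j s IH; rewrite inE negb_or => /andP[ij /IH ->].
  by rewrite mnm1E (negPf ij).
elim: (enum _) => //= j s IH /andP[js us]; rewrite inE mnm1E.
case: eqVneq => [ij _ | ij /= /(IH us) //].
by rewrite out //= ?ij.
Qed.

Lemma polymod_scaleC c (v : polymod mC) : (c%:MP : P) *: v = c *: (v : E) :> E.
Proof.
transitivity (poly_act c%:MP v) => //.
by rewrite -[c%:MP]mulr1 mul_mpolyC poly_actZ poly_act1.
Qed.
End PolyModule.

(* Main.v *)
Require Import Defs.
From HB Require Import structures.
From mathcomp Require Import all_boot all_order all_algebra.
From mathcomp Require Import finmap mpoly.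
From mathcomp Require Import complex boolp reals.

Set Implicit Arguments.
Unset Strict Implicit.
Unset Printing Implicit Defensive.

Import GRing.Theory.
Local Open Scope ring_scope.

(** As [B] is a complement of [ker N] in [W], where [N] has full rank, [N] maps
    [B] bijectively onto its target, so [V] is the direct sum of [B] and
    [ker N]. Since [x_i B] lies in [V], removing the [ker N] component
    rewrites [x_i b] as the element [m_(x_i) b] of [B], without leaving the
    class modulo any ideal [J] that contains [ker N]. By iteration [p b] is
    congruent to [p(m) b] in [B] for every polynomial [p] ([poly_act_mod]), and
    so every multiple of an element of [V] has a representative in [B]
    ([mulr_mspan_mod]).

    Now take [J = I^*] and a monomial [u] in [V]. Monomials are invertible in
    the Laurent ring, so multiplication by [u] is injective on [R/I^*]; as this
    space is finite-dimensional, it is also surjective. Every class is therefore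
    that of a multiple of [u], hence that of an element of [B], and since
    [dim B = delta = dim R/I^*] the map [B -> R/I^*] is bijective
    ([basis_quot_bij]).

    Everything else follows from that bijection. It carries [m_(x_i)] to
    multiplication by [x_i], so these operators commute and it is an isomorphism
    of modules. It forces [B] to meet [I^*] only in [0], whence
    [V \cap I^* = ker N]. Finally, if [p] is in [I^*], then [p u] is congruent
    modulo the ideal generated by [ker N] to an element of [B] that lies in
    [I^*], hence is [0]; so [p u] is in that ideal ([kernel_colon]). *)

(** * Linear bijections, generated and contracted ideals *)

Lemma linear_surj_bij (K : fieldType) (aT rT : vectType K)
    (f : {linear aT -> rT}) :
  dim aT = dim rT -> (forall y, exists x, f x = y) -> bijective f.
Proof.
move=> dimE f_surj; pose g := linfun f.
have g_full : limg g = fullv.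
  apply/vspaceP => y; rewrite memvf; have [x <-] := f_surj y.
  by rewrite -(lfunE f x) memv_img ?memvf.
have g_inj : lker g == 0%VS.
  rewrite -dimv_eq0; have /eqP := limg_ker_dim g fullv.
  by rewrite g_full !dimvf dimE capfv -[X in _ == X]add0n eqn_add2r.
exists (g^-1)%VF => [x|y]; first by rewrite -(lfunE f) lker0_lfunK.
by rewrite -(lfunE f) limg_lfunVK // g_full memvf.
Qed.

Lemma gen_ideal_mem (A : comNzRingType) (G : A -> Prop) x :
  G x -> x \in gen_ideal G.
Proof.
move=> Gx; apply/asboolP; exists 1%N, (fun=> 1), (fun=> x).
by split=> //; rewrite big_ord1 mul1r.
Qed.

Lemma gen_ideal_sub (A : comNzRingType) (G : A -> Prop) (J : ideal A) :
  (forall x, G x -> x \in J) -> {subset gen_ideal G <= J}.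
Proof.
move=> GJ x /asboolP[k [a [g [Gg ->]]]]; apply: rpred_sum => i _.
exact/ideal_mull/GJ.
Qed.

Lemma contr_ideal_cancelM (A A' : comNzRingType) (h : {rmorphism A -> A'})
    (I : ideal A') (u p : A) (u' : A') :
  u' * h u = 1 -> u * p \in contr_ideal h I -> p \in contr_ideal h I.
Proof.
move=> u'K; rewrite !unfold_in rmorphM => /(ideal_mull u').
by rewrite mulrA u'K mul1r.
Qed.

Lemma laurent_monomial_unit (K : fieldType) n (a : 'X_{1..n}) :
  exists u : laurent K n, u * laurent_of 'X_[a] = 1.
Proof.
have uP : (FracField.tofrac ('X_[a] : {mpoly K[n]}))^-1 \in @laurent_pred K n.
  by apply/asboolP; exists 1, a; rewrite tofrac1 div1r.
exists (MkLaurent uP); apply: val_inj => /=; rewrite mulVf //.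
rewrite tofrac_eq0; apply/eqP => /(congr1 (mcoeff a)) /eqP.
by rewrite mcoeffX eqxx mcoeff0 oner_eq0.
Qed.

(** * Coordinates on a finite-dimensional quotient *)

Section Coordinates.
Variables (K : fieldType) (n d : nat) (I : ideal {mpoly K[n]}).
Local Notation P := {mpoly K[n]}.

(** Replaces the quotient, which is only a module over the polynomial ring, by
    the vector space of its coordinates, where ranks and dimensions are
    available: [coord] is reduction modulo [I], and [lift] is a
    linear choice of representatives. *)
Lemma has_dim_coord : has_dim (@mpolyC n K) (quotmod I) d ->
  exists (coord : {linear P -> 'rV[K]_d}) (lift : {linear 'rV[K]_d -> P}),
    cancel lift coord /\ forall p, (coord p == 0) = (p \in I).
Proof.
move=> [e eP].
pose lift (r : 'rV[K]_d) : P := \sum_i r 0 i *: repr (e i : Quotient.quot I).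
have lift_lin : linear lift.
  move=> c r r'; rewrite /lift scaler_sumr -big_split; apply: eq_bigr => i _.
  by rewrite !mxE scalerDl scalerA.
have projlift r : quot_proj I (lift r) = \sum_i (r 0 i)%:MP *: e i.
  rewrite /lift (big_morph (quot_proj I) (id1 := 0) (op1 := +%R)); last 2 first.
  - exact: quot_projD.
  - by apply: (addrI (quot_proj I 0)); rewrite -quot_projD !addr0.
  apply: eq_bigr => i _; rewrite -mul_mpolyC -quot_scaleE.
  by rewrite /quot_proj reprK.
pose coord p := projT1 (cid (eP (quot_proj I p))).
have coordP p r : (coord p = r) <-> (p - lift r \in I).
  rewrite /coord; case: cid => c /= [cE c_uniq].
  split=> [<-|/quot_projE]; first by apply/quot_projE; rewrite projlift.
  by rewrite projlift; apply: c_uniq.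
have coord_lin : linear coord.
  move=> c p q; apply/coordP.
  have /coordP hp := erefl (coord p); have /coordP hq := erefl (coord q).
  rewrite lift_lin opprD addrACA -scalerBr rpredD //.
  by rewrite -mul_mpolyC ideal_mull.
pose coordL : {linear P -> 'rV[K]_d} :=
  HB.pack coord (GRing.isLinear.Build K P 'rV[K]_d _ coord coord_lin).
pose liftL : {linear 'rV[K]_d -> P} :=
  HB.pack lift (GRing.isLinear.Build K 'rV[K]_d P _ lift lift_lin).
exists coordL, liftL; split=> [r|p].
  by apply/coordP; rewrite subrr rpred0.
have lift0 : lift 0 = 0 by apply: (linear0 liftL).
apply/eqP/idP => [/coordP|pI]; last apply/coordP; by rewrite lift0 subr0.
Qed.
End Coordinates.

(** * Reduction of polynomials to the complement of the kernel *)

Section NormalForm.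
Variables (K : fieldType) (n d : nat) (S : {fset 'X_{1..n}}).
Local Notation P := {mpoly K[n]}.
Variables (N : 'Hom(mspan K S, 'cV[K]_d)) (B : {vspace mspan K S}).
(* Two ideals play the role of [J]: [I^*], and the ideal generated by the
   kernel, to which the colon ideals refer. *)
Variable J : ideal P.
Hypothesis NJ : forall v, v \in lker N -> mspan_val v \in J.
Hypothesis capBN : (B :&: lker N = 0)%VS.
Hypothesis addBN : (B + lker N = fullv)%VS.
Hypothesis mulXB : forall i b, b \in B -> 'X_i * mspan_val b \in mspan_pred S.

Lemma subr_mult_op_lker i (b : subvs_of B) :
  mulX i (vsval b) - vsval (mult_op N B i b) \in lker N.
Proof.
rewrite mult_opE -[X in X - _](daddv_pi_add (V := lker N) capBN).
  by rewrite addrAC subrr add0r memv_pi.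
by rewrite addBN memvf.
Qed.

Lemma mult_op_mod i (b : subvs_of B) :
  'X_i * mspan_val (vsval b) - mspan_val (vsval (mult_op N B i b))
    \in J.
Proof.
rewrite -mulXE ?mulXB ?subvsP //.
exact: (NJ (subr_mult_op_lker i b)).
Qed.

(** Each operator [mult_op N B i] multiplies the class modulo [J] by [x_i], so
    the order in which [mnm_act] composes them has no effect on the class. That
    the operators themselves commute is a consequence, drawn in
    [mult_op_commuting] once [B] is known to embed in the quotient. *)
Lemma mnm_act_mod a (b : subvs_of B) :
  'X_[a] * mspan_val (vsval b) - mspan_val (vsval (mnm_act (mult_op N B) a b))
    \in J.
Proof.
rewrite mpolyXE_id -big_enum /= /mnm_act.
elim: (enum _) => [|i r IHr]; rewrite [foldr _ _ _]/=.
  by rewrite big_nil mul1r subrr rpred0.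
rewrite big_cons; set q := \prod_(j <- r) _ in IHr *.
set c := foldr _ _ _ in IHr *.
elim: (a i) => [|k IHk]; first by rewrite expr0 mul1r.
rewrite exprS -!mulrA [iter k.+1 _ _]/= in IHk *; set c' := iter k _ _ in IHk *.
have /rpredD := ideal_mull 'X_i IHk => /(_ _ (mult_op_mod i c')).
by rewrite mulrBr addrA subrK.
Qed.

Lemma poly_act_mod p (b : subvs_of B) :
  p * mspan_val (vsval b) - mspan_val (vsval (poly_act (mult_op N B) p b))
    \in J.
Proof.
elim/mpolyind: p => [|c a p _ _ IHp].
  by rewrite mul0r poly_act0l subrr rpred0.
have valP k (u v : subvs_of B) : mspan_val (vsval (k *: u + v)) =
    k *: mspan_val (vsval u) + mspan_val (vsval v) by rewrite !linearP.
rewrite poly_actDl poly_actZ poly_actX mulrDl valP opprD addrACA rpredD //.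
rewrite -scalerAl -scalerBr -mul_mpolyC.
exact/ideal_mull/mnm_act_mod.
Qed.

(** Modulo [J], [B] contains every multiple of every element of [V]: replace
    [v] by its component in [B], then let [p] act through the operators
    [mult_op]. *)
Lemma mulr_mspan_mod p (v : mspan K S) :
  exists b : subvs_of B, p * mspan_val v - mspan_val (vsval b) \in J.
Proof.
have vE := daddv_pi_add capBN (w := v); rewrite addBN in vE.
have {1}<- := vE (memvf v).
have [c cE] : exists c : subvs_of B, vsval c = daddv_pi B (lker N) v.
  by exists (vsproj B (daddv_pi B (lker N) v)); rewrite vsprojK ?memv_pi.
exists (poly_act (mult_op N B) p c); rewrite -cE linearD mulrDr addrAC.
by rewrite rpredD ?poly_act_mod ?ideal_mull ?NJ ?memv_pi.
Qed.

(** A regular [u] acts injectively, hence surjectively, on the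
    finite-dimensional quotient. So each class is represented by a multiple of
    [u], thus by an element of [B], and a surjection between spaces of equal
    dimension is bijective. *)
Lemma basis_quot_bij (u : mspan K S) :
    has_dim (@mpolyC n K) (quotmod J) (\dim B) ->
    (forall p, mspan_val u * p \in J -> p \in J) ->
  bijective (fun b : subvs_of B => quot_proj J (mspan_val (vsval b))).
Proof.
move=> /has_dim_coord[coord [lift [liftK coord0]]] u_reg.
have coordE p q : p - q \in J -> coord p = coord q.
  by rewrite -coord0 linearB subr_eq0 => /eqP.
pose mul_u r := coord (mspan_val u * lift r).
have mul_u_lin : linear mul_u.
  by move=> c r r'; rewrite /mul_u linearP mulrDr -scalerAr linearP.
pose muL : {linear 'rV[K]_(\dim B) -> 'rV[K]_(\dim B)} :=
  HB.pack mul_u (GRing.isLinear.Build K _ _ _ mul_u mul_u_lin).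
have mul_u_surj r : exists q, coord (mspan_val u * q) = r.
  have mu_ker0 : lker (linfun muL) == 0%VS.
    rewrite -subv0; apply/subvP => x; rewrite memv_ker lfunE memv0 /= coord0.
    by move=> /u_reg; rewrite -coord0 liftK.
  have : r \in limg (linfun muL) by rewrite lker0_limgf ?memvf.
  by move=> /memv_imgP[x _ ->]; exists (lift x); rewrite lfunE.
pose cB (b : subvs_of B) := coord (mspan_val (vsval b)).
have cB_lin : linear cB by move=> c b b'; rewrite /cB !linearP.
pose cBL : {linear subvs_of B -> 'rV[K]_(\dim B)} :=
  HB.pack cB (GRing.isLinear.Build K _ _ _ cB cB_lin).
have [|r|g cBK gK] := @linear_surj_bij K _ _ cBL.
- by rewrite dim_matrix mul1r.
- have [q <-] := mul_u_surj r; have [b /coordE bE] := mulr_mspan_mod q u.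
  by exists b; rewrite mulrC bE.
(* The inverse of [b |-> b mod J] is the inverse of [cB] after [coord]. *)
pose rep (q : quotmod J) : P := projT1 (quot_projP q).
have repK q : quot_proj J (rep q) = q by rewrite /rep; case: quot_projP.
exists (fun q => g (coord (rep q))) => [b|q].
  rewrite -[RHS]cBK /=; congr g; apply: coordE.
  by apply/quot_projE; rewrite repK.
rewrite -[RHS]repK; apply/quot_projE.
rewrite -coord0 linearB subr_eq0; apply/eqP.
exact: (gK (coord (rep q))).
Qed.

(** * Consequences of the injectivity of [B] in the quotient *)

Hypothesis J_inj : injective
  (fun b : subvs_of B => quot_proj J (mspan_val (vsval b))).

Lemma basis_ideal_eq0 (b : subvs_of B) : mspan_val (vsval b) \in J -> b = 0.
Proof.
move=> bJ; apply: J_inj; apply/quot_projE.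
by rewrite (linear0 (@mspan_val K n S)) subr0.
Qed.

Lemma mem_lkerE v : (v \in lker N) = (mspan_val v \in J).
Proof.
apply/idP/idP => [/NJ //|vJ].
have /memv_addP[b bB [k kN vE]] : v \in (B + lker N)%VS by rewrite addBN memvf.
have bJ : mspan_val b \in J.
  by rewrite -(addrK k b) -vE (linearB (@mspan_val K n S)) rpredB // NJ.
have /(congr1 vsval)/= := @basis_ideal_eq0 (Subvs bB) bJ.
by rewrite vE => ->; rewrite add0r.
Qed.

(** Both composites represent the class of [x_i x_j b]. *)
Lemma mult_op_commuting : commuting (mult_op N B).
Proof.
move=> i j b; apply: J_inj; set m := mult_op N B.
have mm k l : quot_proj J (mspan_val (vsval (m k (m l b)))) =
    quot_proj J ('X_k * 'X_l * mspan_val (vsval b)).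
  apply/esym/quot_projE; have := ideal_mull 'X_k (mult_op_mod l b).
  move=> /rpredD/(_ (mult_op_mod k (m l b))).
  by rewrite mulrBr addrA subrK mulrA.
by rewrite !mm (mulrC 'X_i).
Qed.

(** [p] acts on [b] by [poly_act], which agrees with [p * b] modulo [J]. *)
Lemma polymod_quot_linear (mC : commuting (mult_op N B)) :
  exists phi : {linear polymod mC -> quotmod J},
    phi =1 fun b => quot_proj J (mspan_val (vsval b)).
Proof.
pose proj (b : polymod mC) := quot_proj J (mspan_val (vsval b)).
have proj_lin : linear proj.
  move=> p b c; rewrite -[p *: proj b]/(quot_scale p (proj b)) quot_scaleE.
  have valD (x y : subvs_of B) : mspan_val (vsval (x + y)) =
      mspan_val (vsval x) + mspan_val (vsval y) by rewrite !linearD.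
  rewrite -quot_projD; apply/esym/quot_projE.
  rewrite [X in _ - X](valD (poly_act (mult_op N B) p b) c).
  by rewrite opprD addrACA subrr addr0 poly_act_mod.
pose phi : {linear polymod mC -> quotmod J} :=
  HB.pack proj
    (GRing.isLinear.Build P (polymod mC) (quotmod J) _ proj proj_lin).
by exists phi.
Qed.

End NormalForm.

(** For [p] in [J], the representative in [B] of [p * u] modulo [G] lies in [J],
    so it is [0] and [p * u] lies in [G]. *)
Lemma kernel_colon (K : fieldType) n d (S : {fset 'X_{1..n}})
    (N : 'Hom(mspan K S, 'cV[K]_d)) (B : {vspace mspan K S})
    (G J : ideal {mpoly K[n]}) (u : mspan K S) :
    (B :&: lker N = 0)%VS -> (B + lker N = fullv)%VS ->
    (forall i b, b \in B -> 'X_i * mspan_val b \in mspan_pred S) ->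
    (forall v, v \in lker N -> mspan_val v \in G) -> {subset G <= J} ->
    injective (fun b : subvs_of B => quot_proj J (mspan_val (vsval b))) ->
    (forall p, mspan_val u * p \in J -> p \in J) ->
  colon_ideal G (mspan_val u) =i J.
Proof.
move=> capBN addBN mulXB NG GJ J_inj u_reg p.
apply/idP/idP => [/GJ/u_reg //|pJ]; change (mspan_val u * p \in G).
have [b bG] := mulr_mspan_mod NG capBN addBN mulXB p u.
have bJ : mspan_val (vsval b) \in J.
  by rewrite -(rpredBl _ (ideal_mull (mspan_val u) pJ)) mulrC GJ.
have b0 := basis_ideal_eq0 J_inj bJ.
by move: bG; rewrite b0 (linear0 (@mspan_val K n S)) subr0 mulrC.
Qed.

Theorem theorem4p1 (T : realType) (n s : nat)
    (f : 'I_s -> laurent T[i] n) (S : {fset 'X_{1..n}}) (delta : nat)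
    (N : 'Hom(mspan T[i] S, 'cV[T[i]]_delta))
    (W B : {vspace mspan T[i] S}) :
  let I := laurent_ideal f in
  let Istar := star_ideal I in
  let kerN := gen_ideal (fun p : {mpoly T[i][n]} =>
                exists2 v, v \in lker N & p = mspan_val v) in
  let m := mult_op N B in
  zero_dimensional I ->
  has_dim (@mpolyC n T[i]) (quotmod Istar) delta ->
  (0 < delta)%N ->
  (forall v, v \in lker N -> laurent_of (mspan_val v) \in I) ->
  (forall (i : 'I_n) w, w \in W -> 'X_i * mspan_val w \in mspan_pred S) ->
  \dim (N @: W)%VS = delta ->
  (B <= W)%VS ->
  W = (B + (W :&: lker N))%VS ->
  directv (B + (W :&: lker N))%VS ->
  [/\ (* (i) *)
      bijective (fun b : subvs_of B => N (vsval b)),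
      (* (ii) *)
      (exists U : {vspace mspan T[i] S},
        [/\ forall v, (v \in U) = (mspan_val v \in Istar),
            fullv = (B + U)%VS & directv (B + U)%VS])
      /\ (forall a : 'X_{1..n}, ('X_[a] : {mpoly T[i][n]}) \in mspan_pred S ->
            colon_ideal kerN 'X_[a] =i Istar),
      (* (iii) *)
      exists mC : commuting m,
        exists phi : {linear polymod mC -> quotmod Istar}, bijective phi
    & (* (iv) *)
      commuting m /\
      forall (i : 'I_n) (b : subvs_of B),
        N (mulX i (vsval b)) = N (vsval (m i b)) /\
        mspan_val (vsval (m i b)) - 'X_i * mspan_val (vsval b) \in Istar].
Proof.
move=> I Istar kerN m _ dimQ d_gt0 kerI mulXW dimNW sBW W_eq.
move=> /directv_addP capBNW.
(* [V] is the direct sum of [B] and [ker N]. *)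
have capBN : (B :&: lker N = 0)%VS.
  by rewrite -capBNW capvA (capv_idPl sBW).
have imB : (N @: B = N @: W)%VS.
  rewrite W_eq limgD; apply/esym/addv_idPl/subvP => _ /memv_imgP[v vWN ->].
  by move: vWN; rewrite memv_cap memv_ker => /andP[_ /eqP ->]; rewrite mem0v.
have dimB : \dim B = delta by rewrite -(limg_dim_eq capBN) imB.
have im_full : (N @: B = fullv)%VS.
  apply/eqP; rewrite eqEdim subvf dimvf dim_matrix mulr1 imB dimNW.
  exact: leqnn.
have addBN : (B + lker N = fullv)%VS.
  apply/vspaceP => v; rewrite memvf; apply/memv_addP.
  have /memv_imgP[b bB vE] : N v \in (N @: B)%VS by rewrite im_full memvf.
  exists b => //; exists (v - b); last by rewrite addrC subrK.
  by rewrite memv_ker linearB /= vE subrr.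
have mulXB i b : b \in B -> 'X_i * mspan_val b \in mspan_pred S.
  by move=> /(subvP sBW); apply: mulXW.
have NI v : v \in lker N -> mspan_val v \in Istar by apply: kerI.
have NG v : v \in lker N -> mspan_val v \in kerN.
  by move=> vN; apply: gen_ideal_mem; exists v.
have sGI : {subset kerN <= Istar}.
  by apply: gen_ideal_sub => _ [v vN ->]; apply: NI.
have X_reg a p : 'X_[a] * p \in Istar -> p \in Istar.
  have [u uK] := laurent_monomial_unit T[i] a.
  exact: (contr_ideal_cancelM uK).
(* [W] is nonzero because [delta > 0]; this provides a monomial of [V]. *)
have [a aS] : exists a : 'X_{1..n}, ('X_[a] : {mpoly T[i][n]}) \in mspan_pred S.
  have W_neq0 : vpick W != 0.
    rewrite vpick0; apply: contraTneq d_gt0 => W0.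
    by rewrite -dimNW W0 limg0 dimv0.
  exists (mlead (mspan_val (vpick W))).
  rewrite unfold_in msuppX /= andbT.
  exact: (allP (valP (vpick W)) _ (mlead_supp W_neq0)).
have dimQB : has_dim (@mpolyC n T[i]) (quotmod Istar) (\dim B) by rewrite dimB.
have quotB_bij :=
  basis_quot_bij NI capBN addBN mulXB (u := MSpan aS) dimQB (@X_reg a).
have quotB_inj := bij_inj quotB_bij.
have mC : commuting m := mult_op_commuting NI capBN addBN mulXB quotB_inj.
split.
- have [|y|] :=
    @linear_surj_bij _ (subvs_of B) _ (N \o vsval : {linear _ -> _}).
  + by rewrite dim_matrix mulr1.
  + have /memv_imgP[b bB ->] : y \in (N @: B)%VS by rewrite im_full memvf.
    by exists (Subvs bB).
  by move=> g NK gK; exists g.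
- split=> [|b bS].
    exists (lker N); split=> [v|//|]; last exact/directv_addP.
    exact: (mem_lkerE NI addBN quotB_inj).
  exact: (kernel_colon (u := MSpan bS) capBN addBN mulXB NG sGI quotB_inj
    (@X_reg b)).
- exists mC.
  have [phi phiE] := polymod_quot_linear NI capBN addBN mulXB mC.
  by exists phi; apply: eq_bij quotB_bij _ (fsym phiE).
split=> // i b; split.
  apply/eqP; rewrite -subr_eq0 -linearB -memv_ker.
  exact: subr_mult_op_lker.
rewrite -opprB rpredN; exact: mult_op_mod.
Qed.
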